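(* There is a dendrite $D$ and a continuous map $F\colon D\to D$ such that: (i) the map $F$ is weakly mixing but not mixing; (ii) the map $F$ is proximal (in particular, it has a unique periodic point, which is the fixed point).
   Context: A continuum is a compact, connected, nonempty metric space; a dendrite is a continuum in which any two distinct points can be separated by a third point. For a continuous map $f\colon X\to X$ of a compact metric space $(X,d)$: $f$ is transitive if for all nonempty open $U,V\subset X$ there is $n>0$ with $f^n(U)\cap V\neq\emptyset$; weakly mixing if $f\times f$ is transitive on $X\times X$; mixing if for all nonempty open $U,V\subset X$ there is $N>0$ with $f^n(U)\cap V\ne\emptyset$ for all $n\ge N$. A pair $(x,y)$ is proximal if $\liminf_{n\to\infty}d(f^n(x),f^n(y))=0$, and $(X,f)$ is proximal if every pair of points in $X$ is a proximal pair. A point $x$ is periodic if $f^n(x)=x$ for some $n>0$, and fixed if $f(x)=x$. *)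

(* Defs.v *)
From mathcomp Require Import all_boot all_order all_algebra.
From mathcomp Require Import all_classical all_reals all_analysis.

Set Implicit Arguments.
Unset Strict Implicit.
Unset Printing Implicit Defensive.

Import Order.TTheory GRing.Theory Num.Theory.

Local Open Scope classical_set_scope.
Local Open Scope ring_scope.

Definition continuum (R : realType) (X : metricType R) : Prop :=
  [/\ compact [set: X], connected [set: X] & [set: X] !=set0].

(* The equation A `|` B = ~` [set z] forces z to differ from both x and y. *)
Definition point_separates (T : topologicalType) (z x y : T) : Prop :=
  exists A B : set T,
    [/\ A `|` B = ~` [set z], separated A B, A x & B y].

Definition dendrite (R : realType) (X : metricType R) : Prop :=
  continuum X /\
  forall x y : X, x <> y -> exists z : X, point_separates z x y.

Definition top_transitive (T : topologicalType) (f : T -> T) : Prop :=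
  forall U V : set T, open U -> U !=set0 -> open V -> V !=set0 ->
    exists2 n : nat, (0 < n)%N & (iter n f @` U) `&` V !=set0.

Definition weakly_mixing (T : topologicalType) (f : T -> T) : Prop :=
  top_transitive (fun p : T * T => (f p.1, f p.2)).

Definition top_mixing (T : topologicalType) (f : T -> T) : Prop :=
  forall U V : set T, open U -> U !=set0 -> open V -> V !=set0 ->
    exists2 N : nat, (0 < N)%N &
      forall n : nat, (N <= n)%N -> (iter n f @` U) `&` V !=set0.

(* The liminf is taken in \bar R, where it always exists. *)
Definition proximal_pair (R : realType) (X : metricType R) (f : X -> X)
    (x y : X) : Prop :=
  limn_einf (fun n : nat => (mdist (iter n f x) (iter n f y))%:E) = 0%E.

Definition proximal (R : realType) (X : metricType R) (f : X -> X) : Prop :=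
  forall x y : X, proximal_pair f x y.

Definition periodic_point (T : Type) (f : T -> T) (x : T) : Prop :=
  exists2 n : nat, (0 < n)%N & iter n f x = x.

Definition fixed_point (T : Type) (f : T -> T) (x : T) : Prop := f x = x.

(* Main.v *)
Require Import Defs.
From HB Require Import structures.
From mathcomp Require Import all_boot all_order all_algebra.
From mathcomp Require Import all_classical all_reals all_analysis.
From mathcomp Require Import zify ring lra.

(** The dendrite is built over a spacing subshift of {0,1}^N: a word is spaced when
    any two of its 1s are at a distance in a fixed set T of integers. The set T is
    chosen such that both T and its complement contain arbitrarily long intervals.
    A gap at the beginning of a long enough interval in T joins any two given spaced
    words, which gives weak mixing; the complement of T is infinite, which forbids
    mixing; and long intervals in the complement force long runs of zeros in every
    long word ([spaced_window]), which gives proximality.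

    To pass from words to a dendrite, give each spaced word w ending in 1 an arc.
    The arc of w 0^g 1 starts at the point [position g] of the arc of w, and the
    arcs of the words 0^g 1 start at a common origin. A point is determined by the
    lengths that the path from the origin covers along each arc, so the space is a
    closed subset of the cube of all families of numbers in [0, 1] indexed by words;
    the product topology makes all but finitely many branches small, and Tychonoff
    gives compactness. Contracting paths towards the origin gives connectedness, and
    any level of a coordinate that is not a branch position is a single separating
    point ([tree_dendrite]).

    The map deletes the first letter of the labels of the arcs. It is continuous
    because each coordinate of the image is the sum of two coordinates. Since the
    positions of large gaps are dense on each arc, every nonempty open set contains
    a whole branch ([cylinder]), so that topological questions about the map become
    questions about words. For proximality, one long run of zeros brings a point
    near the origin and keeps it there for a prescribed time, during which a second
    point makes its own visit ([near_origin_meet]). A periodic point follows its own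
    visit back to itself and is therefore the origin. *)

Set Implicit Arguments.
Unset Strict Implicit.
Unset Printing Implicit Defensive.
Import Order.TTheory GRing.Theory Num.Theory.
Import numFieldNormedType.Exports.
Local Open Scope classical_set_scope.

(** * Spaced words *)

(** The spacing set: the union of the dyadic blocks [2^k, 2^k.+1) with k odd. Both
    it and its complement contain arbitrarily long intervals, and each block is long
    enough for the gaps in it to be spread evenly over an arc. *)
Definition allowed (n : nat) : bool := odd (trunc_log 2 n).

Definition spaced (w : seq bool) : Prop :=
  forall i j, (i < j)%N -> nth false w i -> nth false w j -> allowed (j - i).

(** Words over the alphabet {0,1} are boolean sequences. Only the nodes will carry
    an arc of the dendrite; a node ends in 1, so that every prolongation of a node
    u to a longer node has the form u 0^g 1 s. *)
Definition node (w : seq bool) : Prop := last false w /\ spaced w.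

Definition nested (u v : seq bool) : bool := prefix u v || prefix v u.

Lemma allowed_thick (l M : nat) : exists2 g, (M < g)%N &
  forall n, (g <= n <= g + l)%N -> allowed n.
Proof.
pose k := (M + l).*2.+1; have hk : (M + l < 2 ^ k)%N.
  apply: (@leq_trans k); first by rewrite /k -addnn; lia.
  by apply/ltnW/ltn_expl.
exists (2 ^ k)%N => [|n /andP[gn ng]]; first by lia.
rewrite /allowed (@trunc_log_eq 2 k) ?/k //=; first by rewrite odd_double.
by rewrite -/k gn expnS; lia.
Qed.

Lemma forbidden_thick (l : nat) :
  exists2 c, (0 < c)%N & forall n, (c <= n <= c + l)%N -> ~~ allowed n.
Proof.
pose k := l.*2; have hk : (l < 2 ^ k)%N.
  apply: (@leq_ltn_trans k); first by rewrite /k -addnn; lia.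
  exact: ltn_expl.
exists (2 ^ k)%N => [|n /andP[gn ng]]; first by lia.
rewrite /allowed (@trunc_log_eq 2 k) ?/k //=; first by rewrite odd_double.
by rewrite -/k gn expnS; lia.
Qed.

Lemma node_nil : ~ node [::]. Proof. by case. Qed.

Lemma node_cons b w : w <> [::] -> node (b :: w) -> node w.
Proof.
case: w => // c w _ [/= lw sw]; split => // i j ij wi wj.
by have := sw i.+1 j.+1 ij wi wj; rewrite subSS.
Qed.

Lemma nth_lt_size w i : nth false w i -> (i < size w)%N.
Proof. by rewrite ltnNge; apply: contraL => /(nth_default _) ->. Qed.

Lemma node_prefix u v : prefix u v -> last false u -> node v -> node u.
Proof.
move=> /prefixP[s ->] lu [_ sv]; split => // i j ij ui uj.
have ju := nth_lt_size uj.
by apply: sv; rewrite ?nth_cat ?ju ?(ltn_trans ij ju).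
Qed.

Lemma nth_zeros g v k :
  nth false (nseq g false ++ v) k = (g <= k)%N && nth false v (k - g).
Proof.
by rewrite nth_cat nth_nseq size_nseq; case: leqP.
Qed.

(** The distance between a 1 of u and a 1 of v after the insertion of g zeros lies
    in [g, g + |u| + |v|]: one long run of allowed distances suffices to
    concatenate. *)
Lemma spaced_cat u v g : spaced u -> spaced v ->
  (forall n, (g <= n <= g + (size u + size v))%N -> allowed n) ->
  spaced (u ++ nseq g false ++ v).
Proof.
move=> su sv ag i j ij; rewrite !(nth_cat _ u) !nth_zeros.
case: (ltnP i (size u)) => iu; case: (ltnP j (size u)) => ju.
- exact: su.
- by move=> ui /andP[gj /nth_lt_size jv]; apply: ag; lia.
- lia.
- move=> /andP[gi vi] /andP[gj vj].
  rewrite (_ : (j - i = (j - size u - g) - (i - size u - g))%N); last by lia.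
  by apply: sv => //; lia.
Qed.

Lemma node_cat u v g : spaced u -> node v ->
  (forall n, (g <= n <= g + (size u + size v))%N -> allowed n) ->
  node (u ++ nseq g false ++ v).
Proof.
move=> su [lv sv] ag; split; last exact: spaced_cat.
by rewrite !last_cat; case: v lv {sv ag}.
Qed.

Lemma spaced_nil : spaced [::]. Proof. by move=> i j _; rewrite nth_nil. Qed.

Lemma node_true : node [:: true].
Proof. by split=> // -[|i] [|j] //=; rewrite nth_nil. Qed.

Lemma last_branch s : last false s ->
  s = [::] \/ exists g s', s = nseq g false ++ true :: s'.
Proof.
elim: s => [|[] s IH]; [by left|by right; exists 0%N, s|].
rewrite /= => ls; right.
case: s => [|b s] // in IH ls *.
by have [//|[g [s' ->]]] := IH ls; exists g.+1, s'.
Qed.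

Lemma prefix_branch u v : prefix u v -> last false v -> u <> v ->
  exists g s, v = u ++ nseq g false ++ true :: s.
Proof.
move=> /prefixP[s ->]; rewrite last_cat => ls neq.
have ls' : last false s by case: s ls neq => //; rewrite cats0.
case: (last_branch ls') neq => [->|[g [s' ->]] _]; first by rewrite cats0.
by exists g, s'.
Qed.

Lemma nestedC u v : nested u v = nested v u.
Proof. exact: orbC. Qed.

Lemma nested_cons b c u v :
  nested (b :: u) (c :: v) = (b == c) && nested u v.
Proof. by rewrite /nested !prefix_cons (eq_sym c) -andb_orr. Qed.

Lemma nested_prefix u v : nested u v -> (size u <= size v)%N -> prefix u v.
Proof.
case/orP => // /prefixP[s ->].
rewrite size_cat -leq_subRL // subnn leqn0 => /nilP ->.
by rewrite cats0 prefix_refl.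
Qed.

Lemma prefix_nested u v w : prefix u w -> prefix v w -> nested u v.
Proof.
rewrite !prefixE => /eqP uw /eqP vw; rewrite /nested.
have [uv|/ltnW vu] := leqP (size u) (size v).
  by rewrite -uw -vw -(take_takel w uv) vw prefix_take.
by rewrite -[X in _ || prefix X _]vw -(take_takel w vu) uw prefix_take orbT.
Qed.

(** Long runs of zeros are unavoidable, with a uniform bound on their position:
    choose c such that c, ..., c + N are all forbidden; a 1 at position i excludes
    every 1 from the window [i + c, i + c + N). *)
Lemma spaced_window N : exists R, forall w, spaced w ->
  exists2 m, (m + N <= R)%N &
    forall j, (m <= j < m + N)%N -> nth false w j = false.
Proof.
have [c c0 fc] := forbidden_thick N.
exists (N + c + N)%N => w sw.
have [/existsP[i wi]|/existsPn w0] := boolP [exists i : 'I_N, nth false w i].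
  have iN := ltn_ord i.
  exists (i + c)%N => [|j ij]; first lia.
  apply/negbTE/negP => wj.
  have /negP := fc (j - i)%N ltac:(lia); apply; apply: sw => //; lia.
exists 0%N => [|j /= jN]; first lia.
by apply/negbTE; have := w0 (Ordinal jN).
Qed.

Local Open Scope ring_scope.

(** * Branch positions *)

(** The point of its parent arc at which a branch with gap g is attached. Inside
    the dyadic block [2^k, 2^k.+1) the residue of g modulo k.+1 takes each value, so
    that the positions met by the gaps of one block form a 1/k.+1-net of ]0, 1]. *)
Definition position (R : realType) (g : nat) : R :=
  let m := (trunc_log 2 g).+1 in (g %% m).+1%:R / m%:R.

Lemma position_gt0 (R : realType) g : 0 < position R g.
Proof. by rewrite divr_gt0. Qed.

Lemma position_le1 (R : realType) g : position R g <= 1.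
Proof. by rewrite ler_pdivrMr // mul1r ler_nat ltn_pmod. Qed.

(** Branch points are dense on every arc, even when the gaps are required to be
    large and to begin a long run of allowed distances. *)
Lemma position_dense (R : realType) (t e : R) (l M : nat) :
  0 <= t <= 1 -> 0 < e -> exists2 g, (M < g)%N &
    `|position R g - t| < e /\ forall n, (g <= n <= g + l)%N -> allowed n.
Proof.
move=> /andP[t0 t1] e0.
(* k is odd, so that its block is allowed; it is so large that the block still
   contains l further integers after two full periods of length k.+1. *)
pose k := (M + l + 3 + Num.truncn e^-1).*2.+1.
have hk : (2 * k.+1 + l + M < 2 ^ k)%N.
  rewrite /k; set q := (_ + Num.truncn _)%N.
  have qk : (M + l + 3 <= q)%N by rewrite leq_addr.
  have : (q ^ 2 < 4 ^ q)%N.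
    by rewrite -[4%N]/(2 ^ 2)%N -expnM mulnC expnM ltn_sqr ltn_expl.
  by rewrite (expnS 2) -muln2 (mulnC q) expnM -mulnn (_ : 2 ^ 2 = 4)%N //; nia.
have ek : (k.+1%:R : R)^-1 < e.
  rewrite invf_plt ?posrE //; apply: (lt_le_trans (truncnS_gt _)).
  by rewrite ler_nat /k -addnn; move: (Num.truncn _) {hk k} => q; lia.
have [r rk hr] : exists2 r, (r <= k)%N & `|r.+1%:R - t * k.+1%:R| <= 1.
  have tk0 : 0 <= t * k.+1%:R by rewrite mulr_ge0.
  have /andP[q1 q2] := truncn_itv tk0.
  have [qk|kq] := leqP (Num.truncn (t * k.+1%:R)) k.
    exists (Num.truncn (t * k.+1%:R)) => //; rewrite ler_norml.
    by move: q1 q2; rewrite -natr1; lra.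
  exists k => //; rewrite ler_norml.
  have : k.+1%:R <= t * k.+1%:R by apply: le_trans q1; rewrite ler_nat.
  have : t * k.+1%:R <= k.+1%:R by rewrite ler_piMl.
  by lra.
have kE n : (2 ^ k <= n < 2 ^ k.+1)%N -> trunc_log 2 n = k.
  exact: trunc_log_eq.
(* The first multiple of k.+1 above 2 ^ k, shifted to the residue r. *)
pose g := ((2 ^ k %/ k.+1).+1 * k.+1 + r)%N.
have gP : (2 ^ k <= g < 2 ^ k + 2 * k.+1)%N.
  have := divn_eq (2 ^ k) k.+1.
  have : (2 ^ k %% k.+1 < k.+1)%N by rewrite ltn_pmod.
  by rewrite /g mulSn; lia.
have gk n : (g <= n <= g + l)%N -> trunc_log 2 n = k.
  by move=> gn; apply: kE; rewrite expnS; lia.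
exists g; first lia; split; last first.
  by move=> n /gk; rewrite /allowed => ->; rewrite /k /= odd_double.
rewrite /position gk ?leqnn ?leq_addr // /g modnMDl modn_small ?ltnS //.
apply: le_lt_trans ek.
rewrite -[X in _ - X](@mulfK _ k.+1%:R) ?pnatr_eq0 // -mulrBl normrM.
by rewrite (@ger0_norm _ k.+1%:R^-1) ?invr_ge0 // ler_piMl ?invr_ge0.
Qed.

(** There are only countably many branch points, while an interval has positive
    Lebesgue measure. *)
Lemma avoid_positions (R : realType) (a b : R) : a < b ->
  exists2 s, a < s < b & forall g, s <> position R g.
Proof.
move=> ab; apply: contrapT => h.
have sub : (`]a, b[%classic : set R) `<=` range (position R).
  move=> s /= sab; apply: contrapT => ns; apply: h; exists s.
    by move: sab; rewrite in_itv.
  by move=> g sg; apply: ns; exists g.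
have c : countable (`]a, b[%classic : set R).
  exact: sub_countable (subset_card_le sub) (card_image_le _ _).
have := countable_lebesgue_measure0 c.
rewrite lebesgue_measure_itv /= lte_fin ab.
by move/eqP; rewrite -EFinB eqe subr_eq0 => /eqP ba; rewrite ba ltxx in ab.
Qed.

(** * The space and its metric *)

(** Coordinates on the dendrite: x w is the length covered along the arc of the
    node w on the way from the origin to x. A path that leaves the arc of w does so
    at a branch point, through an arc whose label extends w; hence the nonzero
    coordinates are labelled by a chain of words, and all but the last of them are
    the positions prescribed by the gaps. *)
Record treelike (R : realType) (x : seq bool -> R) : Prop := Treelike {
  tree_ge0 : forall w, 0 <= x w;
  tree_le1 : forall w, x w <= 1;
  tree_node : forall w, x w != 0 -> node w;
  tree_chain : forall u v, x u != 0 -> x v != 0 -> nested u v;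
  tree_branch : forall w g s, node w ->
    x (w ++ nseq g false ++ true :: s) != 0 -> x w = position R g }.

Record tree (R : realType) :=
  Tree { coord :> seq bool -> R; coordP : treelike coord }.

HB.instance Definition _ (R : realType) := gen_eqMixin (tree R).
HB.instance Definition _ (R : realType) := gen_choiceMixin (tree R).

Lemma tree_ext (R : realType) (x y : tree R) : (forall w, x w = y w) -> x = y.
Proof.
case: x y => x xP [y yP] /= /funext xy; subst y.
by congr Tree; exact: Prop_irrelevance.
Qed.

Section Metric.
Variable R : realType.
Implicit Types x y z : tree R.

(** The weights make the metric induce the topology of coordinatewise
    convergence. *)
Definition wdist x y (w : seq bool) : R := `|x w - y w| / (pickle w).+1%:R.

Definition tdist x y : R := sup (range (wdist x y)).

Lemma coord_dist_le1 x y w : `|x w - y w| <= 1.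
Proof.
rewrite ler_norml; have := tree_ge0 (coordP x) w; have := tree_le1 (coordP x) w.
by have := tree_ge0 (coordP y) w; have := tree_le1 (coordP y) w; lra.
Qed.

Lemma wdist_le x y w : wdist x y w <= tdist x y.
Proof.
apply: (ub_le_sup (E := range (wdist x y))); last by exists w.
exists 1 => _ [v _ <-]; rewrite ler_pdivrMr // mul1r.
by rewrite (le_trans (coord_dist_le1 x y v)) // ler1n.
Qed.

Lemma tdist_le x y e : (forall w, wdist x y w <= e) -> tdist x y <= e.
Proof.
by move=> h; apply: ge_sup; [exists (wdist x y [::]), [::]|move=> _ [w _ <-]].
Qed.

Lemma coord_dist_le x y w : `|x w - y w| <= tdist x y * (pickle w).+1%:R.
Proof. by rewrite -ler_pdivrMr // wdist_le. Qed.

Lemma tdistxx x : tdist x x = 0.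
Proof.
apply/eqP; rewrite eq_le; apply/andP; split.
  by apply: tdist_le => w; rewrite /wdist subrr normr0 mul0r.
by apply: le_trans (wdist_le x x [::]); rewrite divr_ge0.
Qed.

Lemma tdist_positivity x y : tdist x y = 0 -> x = y.
Proof.
move=> xy; apply: tree_ext => w; apply/eqP; rewrite -subr_eq0 -normr_le0.
by have := coord_dist_le x y w; rewrite xy mul0r.
Qed.

Lemma tdist_sym x y : tdist x y = tdist y x.
Proof.
rewrite /tdist; suff -> : wdist x y = wdist y x by [].
by apply/funext => w; rewrite /wdist distrC.
Qed.

Lemma tdist_triangle y x z : tdist x z <= tdist x y + tdist y z.
Proof.
apply: tdist_le => w; apply: le_trans (lerD (wdist_le x y w) (wdist_le y z w)).
by rewrite -mulrDl ler_pM2r ?invr_gt0 // ler_distD.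
Qed.

HB.instance Definition _ := isMetric.Build R (tree R)
  tdistxx tdist_positivity tdist_sym tdist_triangle.

(** Only finitely many coordinates matter at a given precision, since all of
    them lie in the unit interval. *)
Lemma mdist_le e : 0 < e -> exists N, forall x y,
  (forall w, (pickle w < N)%N -> `|x w - y w| <= e) -> mdist x y <= e.
Proof.
move=> e0; exists (Num.truncn e^-1).+1 => x y h; apply: tdist_le => w.
rewrite /wdist ler_pdivrMr //.
have [/h|] := ltnP (pickle w) (Num.truncn e^-1).+1.
  by move=> /le_trans; apply; rewrite ler_peMr ?ler1n // ltW.
move=> Nw; apply: le_trans (coord_dist_le1 x y w) _.
rewrite -ler_pdivrMl // mulr1; apply: le_trans (ltW (truncnS_gt _)) _.
by rewrite ler_nat leqW.
Qed.
End Metric.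

(** * Compactness *)

Section Topology.
Variable R : realType.
Implicit Types x y z : tree R.

Lemma near_mdist x (P : set (tree R)) e :
  0 < e -> (forall y, mdist x y < e -> P y) -> nbhs x P.
Proof.
move=> e0 h; apply/nbhs_ballP; exists e => // y; rewrite ballEmdist; exact: h.
Qed.

Lemma coord_continuous w : continuous (fun x : tree R => x w).
Proof.
move=> x; have FF := nbhs_filter x; apply/cvgrPdist_lt => e e0.
have d0 : 0 < e / (pickle w).+1%:R by rewrite divr_gt0.
apply: (near_mdist d0) => y; rewrite ltr_pdivlMr //.
exact/le_lt_trans/coord_dist_le.
Qed.

Lemma near_coords (T : Type) (F : set_system T) (FF : Filter F)
    (f : T -> seq bool -> R) (c : seq bool -> R) N e :
  (forall w, f t w @[t --> F] --> c w) -> 0 < e ->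
  \forall t \near F, forall w, (pickle w < N)%N -> `|c w - f t w| <= e.
Proof.
move=> cf e0.
have : \forall t \near F, forall i : 'I_N,
    if unpickle i is Some w then `|c w - f t w| <= e else true.
  apply: filter_forall => i; case: (unpickle _) => [w|]; last exact: nearW.
  by have /cvgrPdist_le := cf w; apply.
apply: filterS => t h w wN.
by have := h (Ordinal wN); rewrite [nat_of_ord _]/(pickle w) pickleK.
Qed.

Lemma tree_cvg (T : Type) (F : set_system T) (FF : Filter F)
    (f : T -> tree R) x :
  (forall w, f t w @[t --> F] --> x w) -> f t @[t --> F] --> x.
Proof.
move=> cf A; move/nbhs_ballP => [e /= e0 sub].
have e20 : 0 < e / 2 by rewrite divr_gt0.
have [N hN] := @mdist_le R _ e20.
have := near_coords FF N cf e20; apply: filterS => t ft.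
apply: sub; rewrite ballEmdist /=; apply: le_lt_trans (hN _ _ ft) _.
lra.
Qed.

Lemma tree_continuous (T : topologicalType) (f : T -> tree R) :
  (forall w, continuous (fun t => f t w)) -> continuous f.
Proof. by move=> cf t; apply: tree_cvg => w; exact: cf. Qed.

Lemma closed_nonzero_implies (T : topologicalType) (a : T -> R) (P : Prop) :
  continuous a -> closed [set t | a t != 0 -> P].
Proof.
move=> ca; have [p|np] := pselect P.
  suff -> : [set t | a t != 0 -> P] = setT by exact: closedT.
  by apply/seteqP; split => t /=.
suff -> : [set t | a t != 0 -> P] = a @^-1` [set 0].
  by apply: closed_comp => // *; exact: closed_eq.
apply/seteqP; split => t /=; last by move=> ->; rewrite eqxx.
by move=> h; apply/eqP; apply: contrapT => /negP /h.
Qed.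

Lemma continuousM_fun (T : topologicalType) (a b : T -> R) :
  continuous a -> continuous b -> continuous (fun t => a t * b t).
Proof. by move=> ca cb t; apply: cvgM; [exact: ca|exact: cb]. Qed.

Lemma continuousB_cst (T : topologicalType) (a : T -> R) (c : R) :
  continuous a -> continuous (fun t => a t - c).
Proof. by move=> ca t; apply: cvgB; [exact: ca|exact: cvg_cst]. Qed.

Let cube : topologicalType :=
  prod_topology (fun _ : seq bool => R : topologicalType).

(** Besides the bounds, each defining condition says that some continuous function
    vanishes unless a fixed proposition holds; such conditions are closed. *)
Lemma treelike_compact : compact [set x : cube | treelike x].
Proof.
have pc w : continuous (fun x : cube => x w).
  exact: (@proj_continuous _ (fun=> R) w).
pose S : set cube :=
    \bigcap_w [set x : cube | x w != 0 -> node w] `&`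
    \bigcap_u \bigcap_v [set x : cube | x u * x v != 0 -> nested u v] `&`
    \bigcap_w \bigcap_g \bigcap_s [set x : cube |
      x (w ++ nseq g false ++ true :: s) * (x w - position R g) != 0 ->
      ~ node w].
have closedS : closed S.
  apply: closedI; [apply: closedI|].
  + by apply: closed_bigI => w _; exact: (closed_nonzero_implies (pc w)).
  + apply: closed_bigI => u _; apply: closed_bigI => v _.
    exact: (closed_nonzero_implies (continuousM_fun (pc u) (pc v))).
  + apply: closed_bigI => w _; apply: closed_bigI => g _.
    apply: closed_bigI => s _; apply: closed_nonzero_implies.
    exact: (continuousM_fun (pc _) (continuousB_cst (pc w))).
pose C := [set x : cube | forall w, `[0, 1]%classic (x w)].
have compactC : compact C.
  exact: (@tychonoff _ (fun=> R) (fun=> `[0, 1]%classic)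
    (fun=> @segment_compact R 0 1)).
suff -> : [set x : cube | treelike x] = C `&` S by exact: compact_closedI.
apply/seteqP; split => x.
  case=> x0 x1 xn xc xb; split; [|split; [split|]].
  + by move=> w /=; rewrite in_itv /= x0 x1.
  + by move=> w _; exact: xn.
  + by move=> u _ v _ /=; rewrite mulf_eq0 negb_or => /andP[]; exact: xc.
  + move=> w _ g _ s _ /=; rewrite mulf_eq0 negb_or => /andP[xv /negP h] nw.
    by apply: h; rewrite (xb _ _ _ nw xv) subrr.
case=> x01 [[xn xc] xb]; split.
+ by move=> w; have := x01 w; rewrite /= in_itv => /andP[].
+ by move=> w; have := x01 w; rewrite /= in_itv => /andP[].
+ by move=> w; exact: xn.
+ by move=> u v xu xv; apply: (xc u I v I); rewrite /= mulf_neq0.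
+ move=> w g s nw xv; apply: contrapT => /eqP h.
  by apply: (xb w I g I s I) nw => /=; rewrite mulf_neq0 // subr_eq0.
Qed.

(** Every proper filter has a coordinatewise cluster point by Tychonoff, and the metric
    sees only finitely many coordinates at a time. *)
Lemma tree_compact : compact [set: tree R].
Proof.
move=> F FF _.
have [|c [cP cF]] := @treelike_compact (@coord R @ F) _.
  by apply: (@filterS _ F _ setT) => [x _|]; [exact: coordP|exact: filterT].
exists (Tree cP); split=> // A B FA.
move/nbhs_ballP => [e /= e0 sub].
have e20 : 0 < e / 2 by rewrite divr_gt0.
have [N hN] := @mdist_le R _ e20.
have pc w : t w @[t --> (c : cube)] --> c w.
  exact: (@proj_continuous _ (fun=> R) w).
have Cc := near_coords (nbhs_filter (c : cube)) N pc e20.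
have CA : (@coord R @ F) (@coord R @` A).
  by apply: (@filterS _ F _ A) => // x Ax; exists x.
have [_ [[x Ax <-] xc]] := cF _ _ CA Cc.
exists x; split => //; apply: sub; rewrite ballEmdist /=.
by apply: le_lt_trans (hN (Tree cP) x xc) _; lra.
Qed.

End Topology.

(** * Connectedness and separating points *)

Section Dendrite.
Variable R : realType.
Implicit Types x y z : tree R.

Lemma treelike_origin : treelike (fun _ : seq bool => 0 : R).
Proof.
split=> [_|_|w|u v|w g s _] //; by rewrite eqxx.
Qed.

Definition origin : tree R := Tree treelike_origin.

Lemma nested_coord x u v : x u != 0 -> x v != 0 -> (size u <= size v)%N ->
  prefix u v.
Proof.
by move=> xu xv; apply: nested_prefix; exact: tree_chain (coordP x) _ _ xu xv.
Qed.

Lemma coord_eq0 x w : ~ node w -> x w = 0.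
Proof. by move=> nw; apply/eqP/negPn/negP => /(tree_node (coordP x)). Qed.

Definition clamp (t : R) : R := Num.min 1 (Num.max 0 t).

Lemma clamp_itv t : 0 <= clamp t <= 1.
Proof. by rewrite le_min ler01 le_max lexx ge_min lexx. Qed.

Lemma clamp_eq0 t : t <= 0 -> clamp t = 0.
Proof. by move=> t0; rewrite /clamp (max_idPl t0) (min_idPr _) ?ler01. Qed.

Lemma clamp_eq1 t : 1 <= t -> clamp t = 1.
Proof.
by move=> t1; rewrite /clamp (max_idPr _) ?(min_idPl t1) // (le_trans ler01 t1).
Qed.

Lemma clamp_continuous : continuous clamp.
Proof.
move=> t; apply: continuous_min; first exact: cvg_cst.
by apply: continuous_max; [exact: cvg_cst|exact: cvg_id].
Qed.

(** The homotopy that grows x out of the origin: during the time interval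
    [n, n + 1] the only coordinate that changes is the one indexed by a word of
    length n. Shorter words are complete by then, which keeps the branching
    condition. *)
Lemma retract_treelike x (t : R) :
  treelike (fun w => x w * clamp (t - (size w)%:R)).
Proof.
have [x0 x1 xn xc xb] := coordP x.
have cl (w : seq bool) := clamp_itv (t - (size w)%:R).
split=> [w|w|w|u v|w g s nw].
- by rewrite mulr_ge0 //; have /andP[] := cl w.
- by have /andP[c0 c1] := cl w; rewrite -[leRHS]mulr1 ler_pM.
- by rewrite mulf_eq0 negb_or => /andP[/xn].
- by rewrite !mulf_eq0 !negb_or => /andP[xu _] /andP[xv _]; exact: xc.
- rewrite mulf_eq0 negb_or => /andP[/(xb _ _ _ nw) -> cv].
  rewrite clamp_eq1 ?mulr1 //; apply: contraNT cv; rewrite -ltNge => tw.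
  rewrite clamp_eq0 // !size_cat /= addnA addnS -natr1 natrD.
  have : (0 : R) <= (size (nseq g false))%:R by [].
  have : (0 : R) <= (size s)%:R by [].
  by rewrite !natrD; lra.
Qed.

Definition retract x t : tree R := Tree (retract_treelike x t).

(** Every x is the limit, as t tends to infinity, of the connected set of its
    retracts, which contains the origin at t = 0. *)
Lemma tree_connected : connected [set: tree R].
Proof.
have rc x : continuous (retract x).
  apply: tree_continuous => w t; apply: cvgM; first exact: cvg_cst.
  apply: (@continuous_comp _ _ _ (fun t : R => t - (size w)%:R) clamp);
    last exact: clamp_continuous.
  by apply: cvgB; [exact: cvg_id|exact: cvg_cst].
have r0 x : range (retract x) origin.
  exists 0 => //; apply: tree_ext => w /=.
  by rewrite clamp_eq0 ?mulr0 ?sub0r ?oppr_le0.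
have r1 x : closure (range (retract x)) x.
  have rx : retract x n%:R @[n --> \oo] --> x.
    apply: tree_cvg => w; apply: cvg_near_cst; near=> n.
    rewrite /= clamp_eq1 ?mulr1 // lerBrDl natr1 ler_nat; near: n.
    exact: nbhs_infty_ge.
  move=> B /rx [N _ NB]; exists (retract x N%:R); split; first by exists N%:R.
  exact: NB (leqnn N).
rewrite (_ : setT = \bigcup_(x in setT) closure (range (retract x))).
  apply: bigcup_connected; first by exists origin => x _; exact: subset_closure.
  move=> x _; apply: connected_closure; apply: connected_continuous_connected.
    by apply/connected_intervalP => a b _ _ c _.
  exact: continuous_subspaceT.
by apply/seteqP; split => // x _; exists x.
Unshelve. all: by end_near. Qed.

(** A point of the arc w that is not a branch point is alone at its height: shorter
    words have the coordinate prescribed by w, and nothing is attached there for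
    the longer ones. *)
Lemma coord_inj x y w s : s != 0 -> (forall g, s <> position R g) ->
  x w = s -> y w = s -> x = y.
Proof.
move=> s0 sp xw yw; apply: tree_ext => u.
have [xw0 yw0] : x w != 0 /\ y w != 0 by rewrite xw yw.
have [nu|/coord_eq0 z] := pselect (node u); last by rewrite !z.
have nw := tree_node (coordP x) xw0.
have [->|uw] := eqVneq u w; first by rewrite xw yw.
have [cuw|ncuw] := boolP (nested u w); last first.
  have z z' : z' w != 0 -> z' u = 0.
    move=> zw; apply/eqP; apply: contraNT ncuw => zu.
    exact: tree_chain (coordP z') _ _ zu zw.
  by rewrite !z.
case/orP: cuw => [pu|pw].
  have [g [s' E]] := prefix_branch pu nw.1 (elimN eqP uw).
  have z z' : z' w != 0 -> z' u = position R g.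
    by rewrite E; exact: tree_branch (coordP z') _ _ _ nu.
  by rewrite !z.
have [g [s' E]] := prefix_branch pw nu.1 (fun e => elimN eqP uw (esym e)).
have z z' : z' w = s -> z' u = 0.
  move=> zw; apply/eqP/negPn/negP; rewrite E => zu.
  by apply: (sp g); rewrite -zw; exact: tree_branch (coordP z') _ _ _ nw zu.
by rewrite !z.
Qed.

(** If x and y differ in the coordinate w, choose a value s strictly in between
    that is not a branch position. It is attained by connectedness, at a single
    point z by [coord_inj], so that the level z w = s cuts the dendrite into the two
    open sets below and above s. *)
Lemma tree_dendrite : dendrite (tree R).
Proof.
split.
  by split; [exact: tree_compact|exact: tree_connected|exists origin].
have sep x y w : x w < y w -> exists z, point_separates z x y.
  move=> xy; have [s /andP[xs sy] sp] := avoid_positions xy.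
  have s0 : s != 0.
    by rewrite gt_eqF // (le_lt_trans _ xs) // (tree_ge0 (coordP x)).
  have [z zs] : exists z : tree R, z w = s.
    have : connected ((fun x : tree R => x w) @` setT).
      apply: connected_continuous_connected tree_connected _.
      by apply: continuous_subspaceT; exact: coord_continuous.
    move/connected_intervalP => itv.
    have [|||z _ zs] := itv (x w) (y w) _ _ s; last by exists z.
    - by exists x.
    - by exists y.
    - by rewrite !ltW.
  exists z, [set u : tree R | u w < s], [set u : tree R | s < u w].
  have oL : open [set u : tree R | u w < s].
    apply: (open_comp (f := fun u : tree R => u w)) (@open_lt _ s) => u _.
    exact: coord_continuous.
  have oR : open [set u : tree R | s < u w].
    apply: (open_comp (f := fun u : tree R => u w)) (@open_gt _ s) => u _.
    exact: coord_continuous.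
  split => //.
    apply/seteqP; split => u /=; first by case=> + uz; rewrite uz zs ltxx.
    move=> uz; have [| |us] := ltgtP (u w) s; [by left|by right|].
    by case: uz; exact: coord_inj s0 sp us zs.
  split.
  - apply/seteqP; split=> // u [cu us].
    have [v [/= v1 v2]] := cu _ (open_nbhs_nbhs (conj oR us)).
    by have := lt_trans v1 v2; rewrite ltxx.
  - apply/seteqP; split=> // u [us cu].
    have [v [/= v1 v2]] := cu _ (open_nbhs_nbhs (conj oL us)).
    by have := lt_trans v1 v2; rewrite ltxx.
move=> x y xy.
have [w xyw] : exists w, x w <> y w.
  apply: contrapT => h; apply: xy; apply: tree_ext => w.
  by apply: contrapT => /(ex_intro _ w)/h.
have [/sep//|/sep[z [A [B [AB sAB Ay Bx]]]]|//] := ltgtP (x w) (y w).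
by exists z, B, A; split => //; rewrite ?[B `|` A]setUC // separatedC.
Qed.
End Dendrite.

(** * The shift and its visits to the origin *)

Section Shift.
Variable R : realType.
Implicit Types x y z : tree R.

(** The shift acts on labels by deleting the first letter: the arc of b w is sent
    onto the arc of w, and the arc of the one-letter word 1 collapses to the origin.
    The labels 0 w and 1 w are not nested, so at most one summand is nonzero. *)
Definition shift_coord x (w : seq bool) : R :=
  if w is [::] then 0 else x (false :: w) + x (true :: w).

Lemma shift_coordE x b w : w <> [::] -> x (b :: w) != 0 ->
  shift_coord x w = x (b :: w).
Proof.
move=> w0 xb; have xc : x (~~ b :: w) = 0.
  apply/eqP/negPn/negP => xc; have := tree_chain (coordP x) xb xc.
  by rewrite nested_cons; case: (b).
by case: w b xb xc w0 => // c w [] _ /= -> _; rewrite ?addr0 ?add0r.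
Qed.

Lemma shift_coord_neq0 x w : shift_coord x w != 0 ->
  exists b, [/\ w <> [::], x (b :: w) != 0 & shift_coord x w = x (b :: w)].
Proof.
have [->|/eqP w0 sw] := eqVneq w [::]; first by rewrite eqxx.
suff [b xb] : exists b, x (b :: w) != 0.
  by exists b; split=> //; exact: shift_coordE.
have [xf|] := eqVneq (x (false :: w)) 0; last by exists false.
by exists true; move: sw; case: (w) w0 xf => //= c v _ ->; rewrite add0r.
Qed.

Lemma shift_treelike x : treelike (shift_coord x).
Proof.
have [x0 x1 xn xc xb] := coordP x.
have s_itv w : 0 <= shift_coord x w <= 1.
  have [->|/shift_coord_neq0[b [_ _ ->]]] := eqVneq (shift_coord x w) 0.
    by rewrite lexx ler01.
  by rewrite x0 x1.
split=> [w|w|w|u v|w g s nw].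
- by have /andP[] := s_itv w.
- by have /andP[] := s_itv w.
- by move=> /shift_coord_neq0[b [w0 /xn nb _]]; exact: node_cons nb.
- move=> /shift_coord_neq0[b [_ xu _]] /shift_coord_neq0[c [_ xv _]].
  by have := xc _ _ xu xv; rewrite nested_cons => /andP[].
- move=> /shift_coord_neq0[b [_ xv _]].
  have w0 : w <> [::] by move=> w0; move: nw; rewrite w0 => /node_nil.
  have nbw : node (b :: w).
    apply: node_prefix (xn _ xv); first by rewrite -cat_cons prefix_prefix.
    by case: (w) nw w0 => // c t [].
  have xw : x (b :: w) = position R g by exact: xb nbw xv.
  by rewrite (shift_coordE (b := b)) // xw gt_eqF // position_gt0.
Qed.

Definition tree_shift x : tree R := Tree (shift_treelike x).

Lemma shift_continuous : continuous tree_shift.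
Proof.
apply: tree_continuous => -[|b w] x; first exact: (@cst_continuous _ _ (0 : R)).
exact: (cvgD (@coord_continuous R (false :: b :: w) x)
  (@coord_continuous R (true :: b :: w) x)).
Qed.

Lemma shift_origin : tree_shift (origin R) = origin R.
Proof. by apply: tree_ext => -[|b w]; rewrite /= ?addr0. Qed.

Lemma iter_shift_neq0 n x w : iter n tree_shift x w != 0 ->
  exists2 a, size a = n & x (a ++ w) != 0.
Proof.
elim: n w => [|n IH] w /=; first by exists [::].
move=> /shift_coord_neq0[b [_ /IH[a an xa] _]].
by exists (rcons a b); rewrite ?size_rcons ?an // cat_rcons.
Qed.

Lemma iter_shift_cat a x w : w <> [::] -> x (a ++ w) != 0 ->
  iter (size a) tree_shift x w != 0.
Proof.
move=> w0; elim: a x => [//|b a IH] x xa; rewrite [size _]/= iterSr; apply: IH.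
suff -> : tree_shift x (a ++ w) = x (b :: a ++ w) by [].
by apply: shift_coordE => //; case: (a) => //; case: (w) w0.
Qed.

(** The labels of x of length at most M form a finite chain; its top w, or the empty
    word when there is none, controls all of them. *)
Lemma longest_coord x M : exists w,
  [/\ (size w <= M)%N, spaced w, w = [::] \/ x w != 0 &
      forall u, x u != 0 -> (size u <= M)%N -> prefix u w].
Proof.
have [[u0 xu0 u0M]|h] :=
  pselect (exists2 u0, x u0 != 0 & (size u0 <= M)%N); last first.
  exists [::]; split=> //; [exact: spaced_nil|by left|].
  by move=> u xu uM; case: h; exists u.
pose P k := `[< exists u, [/\ x u != 0, size u = k & (k <= M)%N] >].
have exP : exists k, P k by exists (size u0); apply/asboolP; exists u0.
have PM k : P k -> (k <= M)%N by move=> /asboolP[? []].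
have [k /asboolP[w [xw wk kM]] kmax] := ex_maxnP exP PM.
have [_ sw] := tree_node (coordP x) xw.
exists w; split; [by rewrite wk|by []|by right|move=> u xu uM].
apply: (nested_coord xu xw); rewrite wk; apply: kmax.
by apply/asboolP; exists u.
Qed.

Definition near_origin x N := forall v, (size v <= N)%N -> x v = 0.

(** The window of zeros in the longest relevant label of x: at the time when the
    orbit enters this window, a label of length at most N would have to be a run of
    zeros, whereas labels end in 1. *)
Lemma near_origin_visit N : exists R0, forall x,
  exists2 m, (m + N <= R0)%N & near_origin (iter m tree_shift x) N.
Proof.
have [K hK] := spaced_window N; exists K => x.
have [w [_ sw _ wmax]] := longest_coord x K.
have [m mK wm] := hK w sw; exists m => // v vN.
apply/eqP/negPn/negP => mv; have := tree_node (coordP (iter m tree_shift x)) mv.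
have [a am xav] := iter_shift_neq0 mv.
case/lastP: v vN xav mv => [_ _ _ /node_nil//|v b vN xav _ [+ _]].
rewrite last_rcons; case: b vN xav => // vN xav _.
have /prefixP[s ws] : prefix (a ++ rcons v true) w.
  apply: wmax xav _; rewrite size_cat am.
  by apply: leq_trans mK; rewrite leq_add2l.
have := wm (m + size v)%N; rewrite size_rcons in vN.
rewrite leq_addr ltn_add2l vN => /(_ isT).
rewrite ws -am -catA nth_cat ltnNge leq_addr /= addKn.
by rewrite cat_rcons nth_cat ltnn subnn.
Qed.

Lemma near_origin_iter x N n :
  near_origin x (N + n) -> near_origin (iter n tree_shift x) N.
Proof.
move=> h v vN; apply/eqP/negPn/negP => /iter_shift_neq0[a an].
by rewrite h ?eqxx // size_cat an addnC leq_add2r.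
Qed.

(** Two orbits are near the origin simultaneously: first bring one of them so close
    to it that it stays there for longer than the other one needs for a visit. *)
Lemma near_origin_meet x y N M : exists2 n, (M <= n)%N &
  near_origin (iter n tree_shift x) N /\ near_origin (iter n tree_shift y) N.
Proof.
have [K hK] := near_origin_visit N; have [L hL] := near_origin_visit K.
have [m _ xm] := hL (iter M tree_shift x).
have [n nK yn] := hK (iter m tree_shift (iter M tree_shift y)).
exists (n + (m + M))%N; first by lia.
rewrite !iterD; split => //; apply: near_origin_iter => v vN.
by apply: xm; lia.
Qed.

(** The stay near the origin, taken longer than the period, contains a multiple of
    the period, that is, a return to x. *)
Lemma shift_periodic x : periodic_point tree_shift x -> x = origin R.
Proof.
move=> [n n0 xn]; apply: tree_ext => v /=.
have [K hK] := near_origin_visit (size v + n); have [m _ xm] := hK x.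
have xk k : iter (k * n) tree_shift x = x.
  by elim: k => // k IH; rewrite mulSn iterD IH.
have le : (m <= m * n)%N by rewrite leq_pmulr.
(* The first multiple of n beyond m. *)
have [j jn jm] : exists2 j, (j <= n)%N & (j + m = (m %/ n).+1 * n)%N.
  have := divn_eq m n; have := ltn_pmod m n0; rewrite mulSn => h1 h2.
  by exists (n - m %% n)%N; lia.
rewrite -[in LHS](xk (m %/ n).+1) -jm iterD.
apply: (@near_origin_iter _ (size v)) => // u uv.
by apply: xm; apply: leq_trans uv _; rewrite leq_add2l.
Qed.
End Shift.

(** * Weak mixing, absence of mixing, proximality *)

Section Dynamics.
Variable R : realType.
Implicit Types x y z : tree R.

(** The far end of the arc of w; on the arcs below, the position is read off from
    the number of zeros that follow the prefix u in w. *)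
Definition tip_coord (w u : seq bool) : R :=
  if prefix u w && last false u then
    if u == w then 1 else position R (index true (drop (size u) w))
  else 0.

Lemma tip_treelike w : node w -> treelike (tip_coord w).
Proof.
move=> nw; have supp u : tip_coord w u != 0 -> prefix u w && last false u.
  by rewrite /tip_coord; case: ifP => //; rewrite eqxx.
have tip_itv u : 0 <= tip_coord w u <= 1.
  rewrite /tip_coord; case: ifP => _; last by rewrite lexx ler01.
  case: ifP => _; first by rewrite lexx ler01.
  by rewrite position_le1 ltW // position_gt0.
split=> [u|u|u|u v|u g s nu].
- by have /andP[] := tip_itv u.
- by have /andP[] := tip_itv u.
- by move=> /supp /andP[pu lu]; exact: node_prefix pu lu nw.
- by move=> /supp /andP[pu _] /supp /andP[pv _]; exact: prefix_nested pu pv.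
- move=> /supp /andP[/prefixP[r wE] _].
  rewrite /tip_coord nu.1 wE -!catA prefix_prefix /= drop_size_cat //.
  rewrite -[X in X == _]cats0 eqseq_cat // eqxx /=.
  rewrite (_ : [::] == _ = false); last by case: (g).
  by rewrite index_cat size_nseq mem_nseq andbF /= addn0.
Qed.

Definition tip w (nw : node w) : tree R := Tree (tip_treelike nw).

Lemma tip_neq0 w (nw : node w) u : prefix u w -> last false u -> tip nw u != 0.
Proof.
move=> pu lu; rewrite /= /tip_coord pu lu /=.
case: ifP => _; first exact: oner_neq0.
by rewrite gt_eqF // position_gt0.
Qed.

Lemma pickle_size N : exists M, forall u : seq bool,
  (pickle u < N)%N -> (size u <= M)%N.
Proof.
pose s (i : 'I_N) := size (odflt [::] (@unpickle (seq bool) i)).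
exists (\max_i s i) => u uN; have := @leq_bigmax _ s (Ordinal uN).
by rewrite {1}/s [nat_of_ord _]/(pickle u) pickleK.
Qed.

(** Branches are dense: given x in U, take the last arc w that is visible at the
    precision required by U and attach to it, close to x w, a branch whose gap is so
    large that the whole branch lies in U. *)
Lemma cylinder (U : set (tree R)) : open U -> U !=set0 ->
  exists2 w, node w & forall y, y w != 0 -> U y.
Proof.
move=> oU [x Ux].
have /nbhs_ballP[e /= e0 sub] := open_nbhs_nbhs (conj oU Ux).
have e20 : 0 < e / 2 by rewrite divr_gt0.
have [N hN] := @mdist_le R _ e20.
have [M hM] := pickle_size N.
have [w [wM sw xw wmax]] := longest_coord x M.
have xw01 : 0 <= x w <= 1.
  by rewrite (tree_ge0 (coordP x)) (tree_le1 (coordP x)).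
have [g Mg [gx ga]] := position_dense (size w + 1) M xw01 e20.
have nv : node (w ++ nseq g false ++ [:: true]).
  by apply: node_cat => //; exact: node_true.
set v := w ++ _ in nv; exists v => // y yv; apply: sub; rewrite ballEmdist /=.
apply: (@le_lt_trans _ _ (e / 2)); last by lra.
apply: hN => u /hM uM.
have [nu|/coord_eq0 z] := pselect (node u); last by rewrite !z subrr normr0 ltW.
have [uw|uw] := boolP (prefix u w); last first.
  have -> : x u = 0 by apply/eqP; apply: contraNT uw => xu; exact: wmax.
  suff -> : y u = 0 by rewrite subrr normr0 ltW.
  apply/eqP; apply: contraNT uw => yu.
  have uv : prefix u v.
    by apply: (nested_coord yu yv); rewrite !size_cat size_nseq; lia.
  have wu := prefix_nested uv (prefix_prefix w _).
  (* A label of length at most M < g that passes beyond w within v would end in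
     one of the g zeros. *)
  have [ws|/ltnW su] := leqP (size u) (size w); first exact: nested_prefix.
  have [<-|/eqP uw'] := eqVneq w u; first exact: prefix_refl.
  rewrite nestedC in wu.
  have [h [s uE]] := prefix_branch (nested_prefix wu su) nu.1 uw'.
  have vh : nth false v (size w + h).
    move/prefixP: uv => [r ->]; rewrite uE -!catA nth_cat ltnNge leq_addr /=.
    by rewrite addKn nth_zeros leqnn subnn.
  move: vh uM; rewrite uE !size_cat /= size_nseq.
  rewrite /v nth_cat ltnNge leq_addr /= addKn nth_zeros => /andP[gh _]; lia.
have [E|/eqP uw'] := eqVneq u w.
  rewrite E in nu *; rewrite (tree_branch (coordP y) nu yv) distrC; exact: ltW.
have xw0 : x w != 0.
  case: xw uw => // ->; rewrite prefixs0 => /eqP u0.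
  by rewrite u0 in nu; case: (node_nil nu).
have [h [s wE]] := prefix_branch uw (tree_node (coordP x) xw0).1 uw'.
rewrite wE in xw0; rewrite (tree_branch (coordP x) nu xw0).
rewrite /v wE -!catA in yv; rewrite (tree_branch (coordP y) nu yv).
by rewrite subrr normr0 ltW.
Qed.

(** The tip of the arc of u 0^g v lies beyond the arc of u, and after |u| + g steps
    beyond the arc of v. *)
Lemma shift_hit u v g (nw : node (u ++ nseq g false ++ v)) : node u -> node v ->
  tip nw u != 0 /\ iter (size u + g) (@tree_shift R) (tip nw) v != 0.
Proof.
move=> nu nv; split.
  by apply: tip_neq0; [exact: prefix_prefix|exact: nu.1].
have -> : (size u + g)%N = size (u ++ nseq g false).
  by rewrite size_cat size_nseq.
apply: iter_shift_cat.
  by move=> v0; rewrite v0 in nv; case: (node_nil nv).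
by apply: tip_neq0; rewrite -catA ?prefix_refl //; exact: nw.1.
Qed.

Lemma iter_pair (T : Type) (f : T -> T) n (q : T * T) :
  iter n (fun p => (f p.1, f p.2)) q = (iter n f q.1, iter n f q.2).
Proof. by elim: n => [|n IH] /=; [case: q|rewrite IH]. Qed.

Lemma cylinder2 (U : set (tree R * tree R)) : open U -> U !=set0 ->
  exists w w', [/\ node w, node w' &
    forall y y', y w != 0 -> y' w' != 0 -> U (y, y')].
Proof.
move=> oU [[x x'] Ux].
have [[A B] [/= nA nB] AB] : nbhs (x, x') U by exact: open_nbhs_nbhs.
have [w nw wA] := cylinder (open_interior A) (ex_intro _ x nA).
have [w' nw' wB] := cylinder (open_interior B) (ex_intro _ x' nB).
exists w, w'; split=> // y y' yw yw'; apply: AB; split; apply: interior_subset.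
  exact: wA.
exact: wB.
Qed.

(** Joining u to v and u' to v' with the gaps |u'| + h and |u| + h takes the same
    time |u| + |u'| + h for both pairs. *)
Lemma shift_weakly_mixing : weakly_mixing (@tree_shift R).
Proof.
move=> U V oU U0 oV V0.
have [u [u' [nu nu' uU]]] := cylinder2 oU U0.
have [v [v' [nv nv' vV]]] := cylinder2 oV V0.
have [h h0 ha] := allowed_thick (2 * (size u + size u' + size v + size v')) 0.
have nw : node (u ++ nseq (size u' + h) false ++ v).
  by apply: node_cat => //; [exact: nu.2|move=> n nh; apply: ha; lia].
have nw' : node (u' ++ nseq (size u + h) false ++ v').
  by apply: node_cat => //; [exact: nu'.2|move=> n nh; apply: ha; lia].
have [xu xv] := shift_hit nw nu nv; have [xu' xv'] := shift_hit nw' nu' nv'.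
exists (size u + (size u' + h))%N; first lia.
exists (iter (size u + (size u' + h)) (@tree_shift R) (tip nw),
        iter (size u + (size u' + h)) (@tree_shift R) (tip nw')); split.
  by exists (tip nw, tip nw'); [exact: uU|rewrite iter_pair].
by apply: vV => //; rewrite addnCA.
Qed.

(** A return in time n to the set of points that have left the origin along the arc
    of the word 1 exhibits two 1s at distance n in a spaced word; hence no forbidden
    n is a return time. *)
Lemma shift_not_mixing : ~ top_mixing (@tree_shift R).
Proof.
pose U := [set x : tree R | x [:: true] != 0].
have oU : open U.
  apply: (open_comp (f := fun x : tree R => x [:: true]))
    (@open_neq _ 0) => x _.
  exact: coord_continuous.
have U0 : U !=set0.
  by exists (tip node_true); apply: tip_neq0; rewrite ?prefix_refl.
move=> /(_ U U oU U0 oU U0)[N _ hN].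
have [c c0 fc] := forbidden_thick N.
have [_ [[x xU <-] xc]] := hN (c + N)%N (leq_addl _ _).
have [[|b a] /= an xa] := iter_shift_neq0 xc; first lia.
have := tree_chain (coordP x) xU xa.
rewrite nested_cons => /andP[/eqP bt _]; rewrite -bt in xa.
have [_ sp] := tree_node (coordP x) xa.
have /negP := fc (c + N)%N ltac:(lia); apply.
have := sp 0%N (size a).+1 (ltn0Sn _) isT.
rewrite /= nth_cat ltnn subnn /= subn0 an.
by apply.
Qed.

(** A common visit of the two orbits to a small neighbourhood of the origin makes
    their distance small. *)
Lemma shift_proximal : proximal (@tree_shift R).
Proof.
move=> x y; rewrite /proximal_pair limn_einf_lim; set d := fun n => _.
apply/eqP; rewrite eq_le; apply/andP; split; last first.
  apply: lime_ge; first exact: is_cvg_einfs.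
  apply: nearW => M; apply: le_ereal_inf_tmp => _ [n _ <-].
  by rewrite lee_fin mdist_ge0.
apply: lime_le; first exact: is_cvg_einfs.
apply: nearW => M; apply/lee_addgt0Pr => e e0; rewrite add0e.
have [N hN] := @mdist_le R _ e0; have [L hL] := pickle_size N.
have [n Mn [xn yn]] := near_origin_meet x y L M.
apply: (@le_trans _ _ (d n)); first by apply: ereal_inf_lbound; exists n.
rewrite lee_fin; apply: hN => u /hL uL.
by rewrite xn // yn // subrr normr0 ltW.
Qed.

End Dynamics.

Theorem theorem5p2 (R : realType) :
  exists (D : metricType R) (F : D -> D),
    [/\ dendrite D,
        continuous F,
        weakly_mixing F /\ ~ top_mixing F &
        proximal F /\
        exists p : D, fixed_point F p /\ [set x | periodic_point F x] = [set p]].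
Proof.
exists (tree R), (@tree_shift R); split.
- exact: tree_dendrite.
- exact: shift_continuous.
- by split; [exact: shift_weakly_mixing|exact: shift_not_mixing].
- split; first exact: shift_proximal.
  exists (origin R); split; first exact: shift_origin.
  apply/seteqP; split => x /=; first exact: shift_periodic.
  by move=> ->; exists 1%N => //; exact: shift_origin.
Qed.
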